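(* Let $X$ be a $T_0$-space and $\mathcal{B}$ a family of open subsets of $X$. If $\{f_U\colon U\in\mathcal{B}\}$ is a $\mathcal{B}$-stratification, then the assignment $U_q=f_U^{-1}((q,1])$, where $U\in\mathcal{B}$ and $q\in\mathbb{I}$, defines a $\mathcal{B}$-approximation.
   Context: $\mathbb{I}=(0,1)\cap\mathbb{Q}$. Let $X$ be a $T_0$-space and $\mathcal{B}$ a family of open subsets of $X$. A $\mathcal{B}$-stratification is a family of functions $\{f_U\colon U\in\mathcal{B}\}$, $f_U\colon X\to[0,1]$, such that: (1) $U=f_U^{-1}((0,1])$ for every $U\in\mathcal{B}$; (2) if $U,V\in\mathcal{B}$ and $U\subseteq V$, then $f_U(x)\leqslant f_V(x)$ for every $x\in X$; (3) each $f_U$ is continuous. A $\mathcal{B}$-approximation is an assignment to each $U\in\mathcal{B}$ of a family $\{U_q\colon q\in\mathbb{I}\}$ of open subsets of $X$ such that: (a) $U=\bigcup\{U_q\colon q\in\mathbb{I}\}$ for every $U\in\mathcal{B}$; (b) if $U,V\in\mathcal{B}$ and $U\subseteq V$, then $U_q\subseteq V_q$ for every $q\in\mathbb{I}$; (c) if $U\in\mathcal{B}$ and $p<q$ are in $\mathbb{I}$, then $\operatorname{cl}(U_q)\subseteq U_p$. *)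

(* Defs.v *)
From HB Require Import structures.
From mathcomp Require Import all_boot all_order all_algebra.
From mathcomp Require Import all_classical all_reals all_analysis.

Set Implicit Arguments.
Unset Strict Implicit.
Unset Printing Implicit Defensive.

Import Order.TTheory GRing.Theory Num.Theory.
Import numFieldNormedType.Exports.

Local Open Scope classical_set_scope.
Local Open Scope ring_scope.

(* The index set (0,1) /\ Q *)
Definition ratI : set rat := `]0, 1[%classic.

(* A family indexed by B is a function on all subsets of X whose values outside
   B are unconstrained.  Maps X -> [0,1] are maps X -> R with values in [0,1];
   as [0,1] carries the subspace topology, continuity may be stated in R. *)
Record B_stratification (R : realType) (X : topologicalType) (B : set (set X))
    (f : set X -> X -> R) : Prop := {
  strat_range : forall U, B U -> forall x, f U x \in `[0, 1];
  strat_support : forall U, B U -> U = f U @^-1` `]0, 1]%classic;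
  strat_mono : forall U V, B U -> B V -> U `<=` V ->
    forall x, f U x <= f V x;
  strat_cont : forall U, B U -> continuous (f U)
}.

(* [A U q] is U_q; values at q outside ratI are unconstrained. *)
Record B_approximation (X : topologicalType) (B : set (set X))
    (A : set X -> rat -> set X) : Prop := {
  approx_open : forall U q, B U -> ratI q -> open (A U q);
  approx_cover : forall U, B U -> U = \bigcup_(q in ratI) A U q;
  approx_mono : forall U V, B U -> B V -> U `<=` V ->
    forall q, ratI q -> A U q `<=` A V q;
  approx_closure : forall U p q, B U -> ratI p -> ratI q -> p < q ->
    closure (A U q) `<=` A U p
}.

(* Main.v *)
Require Import Defs.
From HB Require Import structures.
From mathcomp Require Import all_boot all_order all_algebra.
From mathcomp Require Import all_classical all_reals all_analysis.

Set Implicit Arguments.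
Unset Strict Implicit.
Unset Printing Implicit Defensive.

Import Order.TTheory GRing.Theory Num.Theory.
Import numFieldNormedType.Exports.

Local Open Scope classical_set_scope.
Local Open Scope ring_scope.

(** As [f U] is bounded by 1, the preimage of (q,1] is the strict superlevel set of [f U] at q, open
    by continuity. Such sets exhaust the support of [f U] because the rationals are dense, and they
    grow with U because [f U] does. For p < q, the closed superlevel set at q separates the strict
    ones at q and at p. *)

Lemma preimage_oc1E (R : realType) (X : Type) (g : X -> R) (a : R)
    (g_le1 : forall x, g x <= 1) :
  g @^-1` `]a, 1]%classic = g @^-1` [set y | a < y].
Proof.
by apply/seteqP; split => x /=; rewrite in_itv /= g_le1 andbT.
Qed.

Theorem proposition2 (R : realType) (X : topologicalType)
    (X_T0 : kolmogorov_space X) (B : set (set X)) (B_open : B `<=` open)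
    (f : set X -> X -> R) (f_strat : B_stratification B f) :
  B_approximation B (fun U q => f U @^-1` `]ratr q, 1]%classic).
Proof.
have f_le1 U : B U -> forall x, f U x <= 1.
  move=> BU x; have := strat_range f_strat BU x.
  by rewrite in_itv /= => /andP[].
have fE U a : B U -> f U @^-1` `]a, 1]%classic = f U @^-1` [set y | a < y].
  by move=> BU; exact: preimage_oc1E (f_le1 U BU).
split=> [U q BU _|U BU|U V BU BV UV q _|U p q BU _ _ pq].
- rewrite fE//; move/continuousP: (strat_cont f_strat BU); apply; exact: open_gt.
- rewrite {1}(strat_support f_strat BU) fE//; apply/seteqP; split => x.
    (* Density gives a rational q strictly between 0 and [f U x]; the bound [f U x <= 1] then forces
       q < 1, so q lies in [ratI]. *)
    move=> /= fx_gt0; have [q] := rat_in_itvoo fx_gt0.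
    rewrite in_itv /= => /andP[q_gt0 q_lt].
    exists q; last by rewrite fE.
    rewrite /ratI /= in_itv /= -(ltr0q R) q_gt0 /= -(ltr_rat R) rmorph1.
    exact: lt_le_trans (f_le1 U BU x).
  case=> q /=; rewrite /ratI /= in_itv /= => /andP[q_gt0 _].
  by rewrite in_itv /= => /andP[qlt _]; apply: lt_trans qlt; rewrite ltr0q.
- by rewrite !fE// => x /= /lt_le_trans; apply; exact: (strat_mono f_strat).
- rewrite !fE//.
  (* Relaxing > q to >= q gives a closed set, which therefore contains the closure; p < q restores a
     strict inequality at p. *)
  have cl : closed (f U @^-1` [set y | ratr q <= y]).
    by move/continuous_closedP: (strat_cont f_strat BU); apply; exact: closed_ge.
  apply: (@subset_trans _ (f U @^-1` [set y | ratr q <= y])).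
    rewrite [X in _ `<=` X](closure_id _).1//; apply: closure_subset => x /=.
    exact: ltW.
  by move=> x /=; apply: lt_le_trans; rewrite ltr_rat.
Qed.
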